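(* The compact convex set $S'(\mathbb{U}_1)$ attached to the Urysohn sphere $\mathbb{U}_1$ is not a Choquet simplex. In particular, $S'(\mathbb{U}_1)$ is not affinely homeomorphic to the Poulsen simplex.
   Context: The construction $S'$: Let $(X,d)$ be a nonempty separable metric space with $\operatorname{diam}(X)\le 1$. For a sequence $D=(d_n)_{n\ge 1}$ whose terms form a dense subset of $X$, put $\iota_D:X\to[0,1]^{\mathbb{N}}$, $\iota_D(x)=(d(x,d_1),d(x,d_2),\ldots)$, and let $S'_D(X)$ be the closed convex hull of $\iota_D(X)$ in $[0,1]^{\mathbb{N}}$ (product topology). Up to affine homeomorphism $S'_D(X)$ does not depend on the choice of $D$ (a known result of Sabok), and $S'(X)$ denotes $S'_D(X)$ for any such $D$. The Urysohn sphere: the rational Urysohn sphere $\mathbb{Q}\mathbb{U}_1$ is the (unique up to isometry) countable metric space $(D,d)$ with rational distances, of diameter one, with the following extension property: for every finite $F\subset D$ and every map $p:F\to\mathbb{Q}\cap[0,1]$ with $|p(x)-p(y)|\le d(x,y)\le p(x)+p(y)$ for all $x,y\in F$, there is $z\in D$ with $d(z,x)=p(x)$ for all $x\in F$. The Urysohn sphere $\mathbb{U}_1$ is the completion of $\mathbb{Q}\mathbb{U}_1$. A compact metrizable convex set $K$ (in a Hausdorff locally convex space) is a Choquet simplex if each point of $K$ is the barycenter of a unique Borel probability measure carried by the set $\operatorname{ext}(K)$ of extreme points of $K$. The Poulsen simplex is the unique (up to affine homeomorphism) metrizable Choquet simplex with more than one point whose set of extreme points is dense. An affine homeomorphism is an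 affine bijection that is a homeomorphism. *)

(* Defs.v *)
From HB Require Import structures.
From mathcomp Require Import all_boot all_order all_algebra.
From mathcomp Require Import all_classical all_reals all_analysis.
From mathcomp Require Import ring lra.

Set Implicit Arguments.
Unset Strict Implicit.
Unset Printing Implicit Defensive.

Import Order.TTheory GRing.Theory Num.Theory.
Import numFieldNormedType.Exports.

Local Open Scope classical_set_scope.
Local Open Scope ring_scope.

Definition RN (R : realType) : Type := nat -> R.

Section RN_tvs.
Context {R : realType}.

HB.instance Definition _ := GRing.Lmodule.copy (RN R) (nat -> R^o).
HB.instance Definition _ := Uniform.copy (RN R) {ptws nat -> R^o}.

Lemma RN_eval_continuous (i : nat) : continuous (fun x : RN R => x i : R^o).
Proof. exact: (@proj_continuous nat (fun=> R^o : topologicalType) i). Qed.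

Lemma RN_cvg (T : Type) (F : set_system T) (f : T -> RN R) (x : RN R) :
  Filter F -> (forall i, (f t i : R^o) @[t --> F] --> (x i : R^o)) ->
  f @ F --> x.
Proof.
move=> FF h.
have [_] := @pointwise_cvgP nat R^o (f @ F : set_system (nat -> R^o)) x _.
exact.
Qed.

Let RN_add_continuous : continuous (fun x : RN R * RN R => x.1 + x.2).
Proof.
move=> [x y]; apply: RN_cvg => i /=.
have cx : {for (x, y), continuous (fun z : RN R * RN R => z.1 i : R^o)}.
  apply: (@continuous_comp _ _ _ fst (fun x : RN R => x i : R^o)).
    exact: cvg_fst.
  exact: RN_eval_continuous.
have cy : {for (x, y), continuous (fun z : RN R * RN R => z.2 i : R^o)}.
  apply: (@continuous_comp _ _ _ snd (fun x : RN R => x i : R^o)).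
    exact: cvg_snd.
  exact: RN_eval_continuous.
exact: (cvgD cx cy).
Qed.

Let RN_scale_continuous : continuous (fun z : R^o * RN R => z.1 *: z.2).
Proof.
move=> [k x]; apply: RN_cvg => i /=.
have cx : {for (k, x), continuous (fun z : R^o * RN R => z.2 i : R^o)}.
  apply: (@continuous_comp _ _ _ snd (fun x : RN R => x i : R^o)).
    exact: cvg_snd.
  exact: RN_eval_continuous.
exact: (cvgZ cvg_fst cx).
Qed.

Let RN_locally_convex : exists2 B : set_system (RN R),
  (forall b, b \in B -> convex_set b) & basis B.
Proof.
exists [set b | open b /\ convex_set b].
  by move=> b /set_mem[].
split; first by move=> b [].
move=> x.
have FF : Filter (filter_from [set U : set (RN R) |
    (open U /\ convex_set U) /\ U x] id).
  apply: filter_from_filter.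
    exists setT; split=> //; split; first exact: openT.
    by move=> *; rewrite inE.
  move=> U V [[oU cU] Ux] [[oV cV] Vx]; exists (U `&` V) => //.
  split=> //; split; first exact: openI.
  by move=> y z t; rewrite !in_setI => /andP[yU yV] /andP[zU zV]; rewrite cU ?cV.
apply: (@RN_cvg _ _ id x FF) => i V.
rewrite -nbhs_ballE => -[e /= e0 eV].
exists ((fun y : RN R => y i : R^o) @^-1` ball (x i : R^o) e); last first.
  by move=> y /eV.
split; last exact: ballxx.
split.
  apply: open_comp; last exact: ball_open.
  by move=> y _; exact: RN_eval_continuous.
move=> y z t; rewrite !inE -ball_normE /= => yi zi.
have -> : x i - (t%:num *: y + (1 - t%:num) *: z : RN R) i
    = t%:num * (x i - y i) + (1 - t%:num) * (x i - z i).
  change (x i - (t%:num * y i + (1 - t%:num) * z i)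
    = t%:num * (x i - y i) + (1 - t%:num) * (x i - z i)).
  by ring.
apply: le_lt_trans (ler_normD _ _) _; rewrite !normrM.
rewrite (@ger0_norm _ t%:num)// (@ger0_norm _ (1 - t%:num)) ?subr_ge0//.
have t0 : 0 <= t%:num by [].
have t1 : t%:num <= 1 by [].
by have [?|?] := lerP `|x i - y i| `|x i - z i|; nra.
Qed.

HB.instance Definition _ :=
  PreTopologicalNmodule_isTopologicalNmodule.Build (RN R) RN_add_continuous.
HB.instance Definition _ :=
  TopologicalNmodule_isTopologicalLmodule.Build R (RN R) RN_scale_continuous.
HB.instance Definition _ := Uniform_isTvs.Build R (RN R) RN_locally_convex.

End RN_tvs.

Lemma RN_hausdorff (R : realType) : hausdorff_space (RN R).
Proof.
by apply: (@hausdorff_product nat (fun=> R^o : topologicalType)) => _.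
Qed.

Section convexity.
Context {R : realType}.

Definition extreme_points (E : lmodType R) (K : set E) : set E :=
  [set x | K x /\ forall (y z : E) (t : R), K y -> K z -> 0 < t < 1 ->
     x = t *: y + (1 - t) *: z -> y = x /\ z = x].

Definition closed_convex_hull (E : tvsType R) (A : set E) : set E :=
  smallest [set C : set E | closed C /\ convex_set C] A.

Definition metrizable_set (T : topologicalType) (K : set T) : Prop :=
  exists d : T -> T -> R,
  [/\ {in K &, forall x y, 0 <= d x y /\ (d x y = 0 <-> x = y)},
      {in K &, forall x y, d x y = d y x},
      {in K & &, forall x y z, d x z <= d x y + d y z} &
      forall x, K x -> forall A : set T,
        within K (nbhs x) A <->
        exists2 e : R, 0 < e & K `&` [set y | d x y < e] `<=` A].

Definition affinely_homeomorphic (E F : tvsType R) (K : set E) (L : set F) :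
    Prop :=
  exists (f : E -> F) (g : F -> E),
  [/\ set_bij K L f, {in K, cancel f g},
      {within K, continuous f}, {within L, continuous g} &
      forall (x y : E) (t : R), K x -> K y -> 0 <= t <= 1 ->
        f (t *: x + (1 - t) *: y) = t *: f x + (1 - t) *: f y].

(* [(E : zmodType)] makes [0] the base point that the library wants of a
   measurable type *)
Definition borel (E : tvsType R) : Type :=
  @g_sigma_algebraType (E : zmodType) (@open E).

Local Open Scope ereal_scope.

Definition barycenter (E : tvsType R) (mu : probability (borel E) R) (x : E) :
    Prop :=
  forall f : {linear E -> R^o}, continuous f ->
    \int[mu]_y (f y)%:E = (f x)%:E.

(* A Borel measure on K carried by ext K is viewed as a Borel measure on the
   ambient space whose complement of ext K is negligible. *)
Definition boundary_representation (E : tvsType R) (K : set E)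
    (mu : probability (borel E) R) (x : E) : Prop :=
  mu.-negligible (~` extreme_points K) /\ barycenter mu x.

(* Measures are total functions in the library; only their values on
   measurable sets are meaningful.
   Hausdorffness of E is not part of the predicate: RN R has it (RN_hausdorff),
   for other spaces it is to be assumed separately. *)
Definition choquet_simplex (E : tvsType R) (K : set E) : Prop :=
  [/\ compact K, metrizable_set K, convex_set K &
   forall x, K x ->
     exists2 mu : probability (borel E) R,
       boundary_representation K mu x &
       forall nu : probability (borel E) R, boundary_representation K nu x ->
         forall A, measurable A -> mu A = nu A].

Definition poulsen_simplex (E : tvsType R) (K : set E) : Prop :=
  [/\ choquet_simplex K, exists x y, [/\ K x, K y & x <> y] &
      K `<=` closure (extreme_points K)].

End convexity.

Arguments metrizable_set R {T} K.

Section metric_spaces.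
Context {R : realType}.

Definition diameter (X : metricType R) : \bar R :=
  ereal_sup [set (mdist xy.1 xy.2)%:E | xy in [set: X * X]].

Definition complete_space (X : metricType R) : Prop :=
  forall u : nat -> X, cauchy (u @ \oo) -> exists l : X, u @ \oo --> l.

Definition rational_urysohn_sphere (Q : metricType R) : Prop :=
  [/\ countable [set: Q],
      forall x y : Q, exists q : rat, mdist x y = ratr q,
      diameter Q = 1%E &
      forall (F : set Q) (p : Q -> rat), finite_set F ->
        (forall x, F x -> 0 <= p x <= 1) ->
        (forall x y, F x -> F y ->
           `|ratr (p x) - ratr (p y)| <= mdist x y <= ratr (p x) + ratr (p y)) ->
        exists z : Q, forall x, F x -> mdist z x = ratr (p x)].

(* Both spheres are unique up to isometry, hence given as predicates: X is a
   completion of a rational Urysohn sphere Q via the isometric embedding j. *)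
Definition urysohn_sphere (X : metricType R) : Prop :=
  complete_space X /\
  exists (Q : metricType R) (j : Q -> X),
    [/\ rational_urysohn_sphere Q,
        forall x y, mdist (j x) (j y) = mdist x y & dense (range j)].

Lemma urysohn_sphere_diameter (X : metricType R) :
  urysohn_sphere X -> (diameter X <= 1)%E.
Proof.
move=> [_ [Q [j [[_ _ dQ _] jd jD]]]]; apply: ge_ereal_sup => _ [[x y] _ <-].
have near_j (e : R) z : 0 < e -> exists a, mdist z (j a) < e.
  move=> e0; have [|w [wz [a _ aw]]] := jD (ball z e)° _ (@open_interior _ _).
    by exists z; exact: nbhsx_ballx.
  by exists a; have := interior_subset wz; rewrite ballEmdist /= aw.
rewrite lee_fin; apply/ler_addgt0Pl => e e0.
have e20 : 0 < e / 2 by rewrite divr_gt0.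
have [a xa] := near_j _ x e20; have [b yb] := near_j _ y e20.
have ab : mdist (j a) (j b) <= 1.
  rewrite jd -lee_fin -dQ; apply: ereal_sup_ubound.
  by exists (a, b).
have := metric_triangle x (j a) y; have := metric_triangle (j a) (j b) y.
rewrite (metric_sym (j b) y); lra.
Qed.

Definition iota_seq (X : metricType R) (D : nat -> X) (x : X) : RN R :=
  fun n => mdist x (D n).

(* The hull is taken in R^N.  It is the hull in [0,1]^N when diameter X <= 1,
   since the cube is closed and convex (Sprime_cube below). *)
Definition Sprime (X : metricType R) (D : nat -> X) : set (RN R) :=
  closed_convex_hull (range (iota_seq D)).

End metric_spaces.

Section Sprime_facts.
Context {R : realType}.

Let cube : set (RN R) := [set x | forall i, 0 <= x i <= 1].

Let cube_compact : compact cube.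
Proof.
have := @tychonoff nat (fun=> R^o : topologicalType)
  (fun=> `[(0 : R), 1]%classic) (fun=> @segment_compact R 0 1).
congr compact; apply/seteqP; split=> x xc i; have := xc i; rewrite /= in_itv//=.
Qed.

Let cube_convex : convex_set cube.
Proof.
move=> x y t; rewrite !inE => xc yc i.
have t0 : 0 <= t%:num by [].
have t1 : t%:num <= 1 by [].
change (0 <= t%:num * x i + (1 - t%:num) * y i <= 1).
by have /andP[? ?] := xc i; have /andP[? ?] := yc i; apply/andP; split; nra.
Qed.

Let cube_metrizable (K : set (RN R)) : K `<=` cube -> metrizable_set R K.
Proof.
move=> Kc.
pose D (x y : RN R) := [set `|x n - y n| / n.+1%:R | n in [set: nat]].
pose d x y := sup (D x y).
have le1 x y n : K x -> K y -> `|x n - y n| / n.+1%:R <= n.+1%:R^-1.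
  move=> /Kc/(_ n)/andP[? ?] /Kc/(_ n)/andP[? ?].
  rewrite ler_piMl ?invr_ge0//.
  by rewrite ler_norml; apply/andP; split; lra.
have Dsup x y : K x -> K y -> has_sup (D x y).
  move=> Kx Ky; split; first by exists (`|x 0%N - y 0%N| / 1%:R); exists 0%N.
  exists 1 => _ [n _ <-]; apply: le_trans (le1 _ _ _ Kx Ky) _.
  by rewrite invf_le1// ler1n.
have Dle x y n : K x -> K y -> `|x n - y n| / n.+1%:R <= d x y.
  by move=> Kx Ky; apply: sup_upper_bound; [exact: Dsup|exists n].
have leD x y e : (forall n, `|x n - y n| / n.+1%:R <= e) -> d x y <= e.
  move=> h; apply: ge_sup; first by exists (`|x 0%N - y 0%N| / 1%:R); exists 0%N.
  by move=> _ [n _ <-].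
have d0 x y : K x -> K y -> 0 <= d x y.
  by move=> Kx Ky; apply: le_trans (Dle _ _ 0%N Kx Ky); rewrite divr_ge0.
exists d; split.
- move=> x y /set_mem Kx /set_mem Ky; split; first exact: d0.
  split=> [dxy|->]; last first.
    apply/eqP; rewrite eq_le d0// andbT; apply: leD => n.
    by rewrite subrr normr0 mul0r.
  apply/funext => n; have := Dle _ _ n Kx Ky; rewrite dxy.
  rewrite pmulr_lle0 ?invr_gt0 ?ltr0n// normr_le0 subr_eq0.
  by move=> /eqP.
- move=> x y _ _; congr sup; apply/seteqP.
  by split=> _ [n _ <-]; exists n => //; rewrite distrC.
- move=> x y z /set_mem Kx /set_mem Ky /set_mem Kz; apply: leD => n.
  apply: le_trans (lerD (Dle _ _ n Kx Ky) (Dle _ _ n Ky Kz)).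
  by rewrite -mulrDl ler_wpM2r ?invr_ge0// ler_distD.
move=> x Kx A; split.
- pose F : set_system (RN R) := filter_from [set e : R | 0 < e]
    (fun e => K `&` [set y | d x y < e]).
  have FF : Filter F.
    apply: filter_from_filter; first by exists 1 => /=.
    move=> e1 e2 /= e10 e20; exists (Num.min e1 e2) => /=.
      by rewrite lt_min e10.
    by move=> y [Ky]; rewrite /= lt_min => /andP[].
  have Fx : F --> x.
    apply: (@RN_cvg R _ _ id x FF) => i V.
    rewrite -nbhs_ballE => -[e /= e0 eV].
    exists (e / i.+1%:R); first by rewrite /= divr_gt0 ?ltr0n.
    move=> y [Ky /= xy]; apply: eV; rewrite -ball_normE /=.
    have := le_lt_trans (Dle _ _ i Kx Ky) xy.
    by rewrite ltr_pM2r ?invr_gt0 ?ltr0n.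
  by move=> /Fx[e /= e0 eA]; exists e => // y [Ky xy]; apply: eA => //.
- move=> [e e0 eA].
  have e20 : 0 < e / 2 by rewrite divr_gt0.
  pose N := Num.truncn (e / 2)^-1.
  have near_i (i : 'I_N) : nbhs x [set y : RN R | `|x i - y i| < e / 2].
    rewrite -[X in nbhs _ X]/((fun y : RN R => y i : R^o) @^-1`
      ball_ Num.norm (x i : R^o) (e / 2)).
    by apply: RN_eval_continuous; rewrite ball_normE; exact: nbhsx_ballx.
  have near_all : nbhs x
      [set y : RN R | forall i : 'I_N, `|x i - y i| < e / 2].
    exact: (filter_forall _ near_i).
  apply: (filterS _ near_all) => y xy Ky; apply: eA; split=> //=.
  have e2e : e / 2 < e by rewrite ltr_pdivrMr// ltr_pMr// ltr1n.
  apply: le_lt_trans e2e; apply: leD => n.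
  have [nN|nN] := ltnP n N.
    apply: le_trans (ltW (xy (Ordinal nN))).
    by rewrite ler_piMr// invf_le1// ler1n.
  apply: le_trans (le1 _ _ _ Kx Ky) _.
  rewrite -[leRHS]invrK lef_pV2 ?posrE ?invr_gt0 ?ltr0n//.
  apply: ltW; apply: lt_le_trans (truncnS_gt _) _.
  by rewrite ler_nat ltnS.
Qed.

Variables (X : metricType R) (D : nat -> X).

Lemma Sprime_convex : convex_set (Sprime D).
Proof.
move=> x y t /set_mem xS /set_mem yS; apply/mem_set => C [[cC vC] DC].
by apply/set_mem/vC; apply/mem_set; [exact: xS|exact: yS].
Qed.

Lemma Sprime_closed : closed (Sprime D).
Proof. by apply: closed_bigI => C [[]]. Qed.

Hypothesis diamX : (diameter X <= 1)%E.

Lemma Sprime_cube : Sprime D `<=` [set x | forall i, 0 <= x i <= 1].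
Proof.
apply: smallest_sub.
  split; last exact: cube_convex.
  exact: (compact_closed (@RN_hausdorff R) cube_compact).
move=> _ [x _ <-] i; rewrite /iota_seq mdist_ge0/=.
rewrite -lee_fin; apply: le_trans diamX.
by apply: ereal_sup_ubound; exists (x, D i).
Qed.

Lemma Sprime_compact : compact (Sprime D).
Proof.
exact: (subclosed_compact Sprime_closed cube_compact Sprime_cube).
Qed.

Lemma Sprime_metrizable : metrizable_set R (Sprime D).
Proof. exact: cube_metrizable Sprime_cube. Qed.

End Sprime_facts.

(* Main.v *)
(** By the extension property, S'(U_1) contains every function with values in
    [0, 1] that satisfies the Katetov inequalities
    |f x - f y| <= d(x, y) <= f x + f y. Let c_0, ..., c_4 be pairwise at
    distance 1 and, for a set S of indices, let
    f_S(x) = min(1, min_(i in S) (1/2 + d(x, c_i))). If S has at least three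
    elements, then f_S is an extreme point: the sums over the pairs of an
    equilateral triangle force the value 1/2 at each c_i, and f_S is the
    largest extension of these values. As d(c_a, c_b) = 1, moreover
    f_(S + a) + f_(S + b) = f_S + f_(S + a + b), so that the midpoint of two
    extreme points is also the midpoint of two others, which contradicts the
    uniqueness of the representing boundary measure. Affine bijections preserve
    such a configuration. *)

Require Import Defs.
From HB Require Import structures.
From mathcomp Require Import all_boot all_order all_algebra.
From mathcomp Require Import all_classical all_reals all_analysis.
From mathcomp Require Import measurable_realfun ring lra.

Set Implicit Arguments.
Unset Strict Implicit.
Unset Printing Implicit Defensive.

Import Order.TTheory GRing.Theory Num.Theory.
Import numFieldNormedType.Exports.

Local Open Scope classical_set_scope.
Local Open Scope ring_scope.

(** * Midpoints and uniqueness of boundary measures *)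

Section midpoint_measure.
Context {R : realType} {E : tvsType R}.
Local Open Scope ereal_scope.

Definition midpoint_measure (p q : borel E) : set (borel E) -> \bar R :=
  measure_add (mscale (2^-1)%:nng%R (dirac p)) (mscale (2^-1)%:nng%R (dirac q)).

HB.instance Definition _ (p q : borel E) :=
  Measure.copy (midpoint_measure p q)
    (measure_add (mscale (2^-1)%:nng%R (dirac p))
                 (mscale (2^-1)%:nng%R (dirac q))).

Lemma midpoint_measureE (p q : borel E) (A : set (borel E)) :
  midpoint_measure p q A = (2^-1 * \1_A p + 2^-1 * \1_A q)%:E.
Proof. by rewrite /midpoint_measure measure_addE. Qed.

Lemma midpoint_measure_setT (p q : borel E) :
  midpoint_measure p q setT = 1.
Proof. by rewrite midpoint_measureE !indicE !in_setT /=; congr EFin; lra. Qed.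

HB.instance Definition _ (p q : borel E) :=
  Measure_isProbability.Build _ _ _ (midpoint_measure p q)
    (midpoint_measure_setT p q).

Lemma ge0_integral_midpoint (p q : borel E) (f : borel E -> \bar R) :
  measurable_fun setT f -> (forall x, 0 <= f x) ->
  \int[midpoint_measure p q]_x f x = (2^-1)%:E * f p + (2^-1)%:E * f q.
Proof.
move=> mf f0.
rewrite /midpoint_measure ge0_integral_measure_add// !ge0_integral_mscale//.
by rewrite !integral_dirac// !diracT !mul1e.
Qed.

Lemma integral_midpoint (p q : borel E) (f : borel E -> R) :
  measurable_fun setT f ->
  \int[midpoint_measure p q]_x (f x)%:E = (2^-1 * f p + 2^-1 * f q)%:E.
Proof.
move=> /measurable_EFinP mf; rewrite integralE.
rewrite !ge0_integral_midpoint//; last 2 first.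
- exact: measurable_funeneg.
- exact: measurable_funepos.
rewrite !funeposE !funenegE -!EFin_max -!EFinM -!EFinD; congr EFin.
by rewrite !maxEle; do ! case: ifPn; lra.
Qed.

Lemma continuous_borel_measurable (f : E -> R^o) :
  continuous f -> measurable_fun [set: borel E] (f : borel E -> R).
Proof.
move=> cf; apply: (measurability _ (RGenOpens.measurableE R)).
move=> _ [_ [x [y ->]] <-]; apply: sub_sigma_algebra; rewrite setTI.
by apply: open_comp => [? _|]; [exact: cf|exact: interval_open].
Qed.

Lemma measurable_borel_set1 (x : E) : hausdorff_space E ->
  measurable ([set x] : set (borel E)).
Proof.
move=> hE; rewrite -[X in measurable X]setCK; apply: measurableC.
apply: sub_sigma_algebra; rewrite openC.
exact: (accessible_closed_set1 (hausdorff_accessible hE)).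
Qed.

Lemma midpoint_measure_boundary (K : set E) (p q : E) : hausdorff_space E ->
  extreme_points K p -> extreme_points K q ->
  boundary_representation K (midpoint_measure p q)
    ((2^-1)%R *: p + (2^-1)%R *: q)%R.
Proof.
move=> hE Kp Kq; split.
  (* Negligibility asks for a measurable null set around the complement of [extreme_points K]; the
     complement of {p, q} serves. *)
  exists (~` ([set p] `|` [set q])); split.
  - by apply/measurableC/measurableU; exact: measurable_borel_set1.
  - rewrite /= midpoint_measureE !indicE !memNset ?mulr0 ?addr0//.
      by apply; right.
    by apply; left.
  - by apply: subsetC => x [] ->.
move=> f cf; rewrite integral_midpoint; last exact: continuous_borel_measurable.
by rewrite linearD !linearZ.
Qed.

(** The two boundary measures of the common midpoint differ on {p}: the first has mass at least 1/2
    there ([q] may equal [p]), the second none. *)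
Lemma not_choquet_simplex (K : set E) (p q r s : E) : hausdorff_space E ->
  K ((2^-1)%R *: p + (2^-1)%R *: q)%R ->
  extreme_points K p -> extreme_points K q ->
  extreme_points K r -> extreme_points K s ->
  ((2^-1)%R *: p + (2^-1)%R *: q = (2^-1)%R *: r + (2^-1)%R *: s)%R ->
  p <> r -> p <> s -> ~ choquet_simplex K.
Proof.
move=> hE Kx Kp Kq Kr Ks pqrs pr ps [_ _ _ /(_ _ Kx)[mu _ muU]].
have mp := measurable_borel_set1 p hE.
have := muU _ (midpoint_measure_boundary hE Kp Kq) _ mp.
have := midpoint_measure_boundary hE Kr Ks; rewrite -pqrs => /muU/(_ _ mp) ->.
rewrite /= !midpoint_measureE !indicE [p \in _]mem_set//.
rewrite [r \in _]memNset; last by move=> /esym.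
rewrite [s \in _]memNset; last by move=> /esym.
by move=> [] /=; have := ler0n R (q \in ([set p] : set (borel E))); lra.
Qed.

End midpoint_measure.

(** * Equilateral sets in the rational Urysohn sphere *)

Section urysohn.
Context {R : realType}.

(** Induction on [n]: the extension property for the constant 1 adds a point at distance 1 from all
    earlier ones. *)
Lemma rational_urysohn_equilateral (Q : metricType R) (n : nat) :
  rational_urysohn_sphere Q ->
  exists c : 'I_n -> Q, forall i k, i != k -> mdist (c i) (c k) = 1.
Proof.
move=> [_ _ dQ extQ].
have d1 (x y : Q) : mdist x y <= 1.
  by rewrite -lee_fin -dQ; apply: ereal_sup_ubound; exists (x, y).
elim: n => [|n [c cE]].
  by exists (fun i : 'I_0 => match notF (ltn_ord i) with end) => -[].
have [||x y _ _|z zE] := extQ (range c) (fun=> 1%Q).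
- exact: finite_image.
- by move=> x _; rewrite ler01 lexx.
- by rewrite rmorph1 subrr normr0 mdist_ge0/= (le_trans (d1 x y))// ler_wpDr.
have zc i : mdist z (c i) = 1 by rewrite zE ?rmorph1//; exists i.
exists (fun i => oapp c z (unlift ord_max i)) => i k.
have [i' ->|->] := unliftP ord_max i; have [k' ->|->] := unliftP ord_max k;
  rewrite ?liftK ?unlift_none ?eqxx//=.
by rewrite (inj_eq lift_inj); exact: cE.
by rewrite metric_sym.
Qed.

Lemma dense_near (X : metricType R) (T : Type) (g : T -> X) (x : X) (e : R) :
  dense (range g) -> 0 < e -> exists t, mdist x (g t) < e.
Proof.
move=> gD e0; have [|w [wx [t _ tw]]] := gD (ball x e)° _ (@open_interior _ _).
  by exists x; exact: nbhsx_ballx.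
by exists t; have := interior_subset wx; rewrite ballEmdist /= tw.
Qed.

(** * Inequalities valid on S' and Katetov functions in S' *)

Section Sprime.
Variables (X : metricType R) (D : nat -> X).

(** The inequality cuts out a closed convex set that contains the image of [iota_seq D], hence the
    hull. *)
Lemma Sprime_lipschitz (y : RN R) (m n : nat) :
  Sprime D y -> y m - y n <= mdist (D m) (D n).
Proof.
move: y; apply: smallest_sub; last first.
  move=> _ [x _ <-]; rewrite /iota_seq lerBlDr [leRHS]addrC.
  by rewrite (metric_sym (D m)); exact: metric_triangle.
split.
  apply: (@closed_comp _ _ (fun y : RN R => y m - y n : R^o) [set r | r <= _]).
    move=> y _ /=.
    have cm := @RN_eval_continuous R m y; have cn := @RN_eval_continuous R n y.
    exact: (cvgB cm cn).
  exact: closed_le.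
move=> y z t; rewrite !inE => ym zm.
change (t%:num * y m + (1 - t%:num) * z m - (t%:num * y n + (1 - t%:num) * z n)
  <= mdist (D m) (D n)).
have : 0 <= t%:num by [].
by have : t%:num <= 1 by []; nra.
Qed.

Lemma Sprime_sum (y : RN R) (m n : nat) :
  Sprime D y -> mdist (D m) (D n) <= y m + y n.
Proof.
move: y; apply: smallest_sub; last first.
  move=> _ [x _ <-]; rewrite /iota_seq (metric_sym x (D m)).
  exact: metric_triangle.
split.
  apply: (@closed_comp _ _ (fun y : RN R => y m + y n : R^o) [set r | _ <= r]).
    move=> y _ /=.
    have cm := @RN_eval_continuous R m y; have cn := @RN_eval_continuous R n y.
    exact: (cvgD cm cn).
  exact: closed_ge.
move=> y z t; rewrite !inE => ym zm.
change (mdist (D m) (D n) <=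
  t%:num * y m + (1 - t%:num) * z m + (t%:num * y n + (1 - t%:num) * z n)).
have : 0 <= t%:num by [].
by have : t%:num <= 1 by []; nra.
Qed.

Lemma Sprime_cvg (u : nat -> X) (y : RN R) :
  (forall n, mdist (u k) (D n) @[k --> \oo] --> y n) -> Sprime D y.
Proof.
move=> uy C [[cC _] DC].
have uy' : (iota_seq D \o u : nat -> RN R) @ \oo --> y by apply: RN_cvg.
apply: (closed_cvg C cC _ _ uy').
by near=> k; apply: DC; exists (u k).
Unshelve. all: by end_near. Qed.

Lemma katetov_Sprime (Q : metricType R) (j : Q -> X) (f : X -> R) :
  rational_urysohn_sphere Q -> (forall x y, mdist (j x) (j y) = mdist x y) ->
  dense (range j) -> (forall x, 0 <= f x <= 1) ->
  (forall x y, `|f x - f y| <= mdist x y <= f x + f y) ->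
  (forall q, exists r : rat, f (j q) = ratr r) ->
  Sprime D (fun n => f (D n)).
Proof.
move=> [_ _ _ extQ] jd jD f01 fK /choice[p pE].
(* Each [D n] is replaced by a nearby point of [Q], where [f] is rational and the extension property
   applies; the error counts twice, in [f] and in the distance. *)
have near k : exists x, forall n, (n < k)%N ->
    `|f (D n) - mdist x (D n)| <= 2 * k.+1%:R^-1.
  have : 0 < k.+1%:R^-1 :> R by rewrite invr_gt0 ltr0n.
  move: k.+1%:R^-1 => d d0.
  have /choice[q qE] n := dense_near (D n) jD d0.
  have [||x y _ _|z zE] := extQ (q @` `I_k) p.
  - exact/finite_image/finite_II.
  - by move=> x _; have := f01 (j x); rewrite pE ler0q -(ler_rat R) rmorph1.
  - by have := fK (j x) (j y); rewrite jd !pE.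
  exists (j z) => n nk.
  have zq : mdist (j z) (j (q n)) = f (j (q n)).
    by rewrite jd pE zE//; exists n.
  have /andP[fl _] := fK (D n) (j (q n)).
  have := qE n.
  have := metric_triangle (j z) (D n) (j (q n)).
  have := metric_triangle (j z) (j (q n)) (D n).
  rewrite (metric_sym (j (q n)) (D n)) zq.
  by move: fl; rewrite !ler_norml => /andP[? ?] ? ? ?; apply/andP; split; lra.
have [u uE] := choice near.
apply: (@Sprime_cvg u) => n.
apply/cvgrPdist_le => e e0; near=> k.
apply: le_trans (uE k n _) _; first by near: k; exists n.+1.
rewrite -ler_pdivlMl//; near: k.
have e20 : 0 < 2^-1 * e by rewrite mulr_gt0.
have /cvgrPdist_le/(_ _ e20) := @cvg_harmonic R.
apply: filterS => k /=; rewrite sub0r normrN ger0_norm//.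
Unshelve. all: by end_near. Qed.

End Sprime.

(** * Capped distances to equilateral points *)

Section equilateral.
Variables (X : metricType R) (n : nat) (c : 'I_n -> X).
Implicit Types (x y : X) (S T : {set 'I_n}).

(** The default 1 of the minimum is the cap. This is the largest 1-Lipschitz function bounded by 1
    everywhere and by 1/2 at each [c i], [i] in [S]. *)
Definition capped_dist S x : R :=
  \big[Order.min/1]_(i in S) (2^-1 + mdist x (c i)).

Lemma capped_dist_le1 S x : capped_dist S x <= 1.
Proof. exact: bigmin_le_id. Qed.

(** As distances are at most 1, this gives the Katetov bound d(x, y) <= f x + f y. *)
Lemma capped_dist_ge S x : 2^-1 <= capped_dist S x.
Proof.
apply: le_bigmin => [|i _]; first by lra.
by rewrite lerDl mdist_ge0.
Qed.

Lemma capped_dist_le S x i :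
  i \in S -> capped_dist S x <= 2^-1 + mdist x (c i).
Proof. exact: bigmin_le_cond. Qed.

Lemma capped_dist_lipschitz S x y :
  capped_dist S x <= capped_dist S y + mdist x y.
Proof.
rewrite -lerBlDr; apply: le_bigmin => [|i iS].
  by have := capped_dist_le1 S x; have := mdist_ge0 x y; lra.
have := capped_dist_le x iS; have := metric_triangle x y (c i); lra.
Qed.

Lemma capped_distU S T x :
  capped_dist (S :|: T) x = Num.min (capped_dist S x) (capped_dist T x).
Proof. exact: bigminU. Qed.

Hypothesis c1 : forall i k, i != k -> mdist (c i) (c k) = 1.

(* A point cannot be within 1/2 of both c a and c b, so one of the two
   capped distances is 1. *)
Lemma capped_dist_modular S a b x : a != b ->
  capped_dist (S :|: [set a]) x + capped_dist (S :|: [set b]) x =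
  capped_dist S x + capped_dist (S :|: ([set a] :|: [set b])) x.
Proof.
move=> ab; rewrite !capped_distU.
have u1 := capped_dist_le1 S x.
have : capped_dist [set a] x = 1 \/ capped_dist [set b] x = 1.
  rewrite /capped_dist !bigmin_set1.
  have := metric_triangle (c a) x (c b); rewrite c1// (metric_sym (c a)).
  have [ax|ax] := leP 1 (2^-1 + mdist x (c a)); first by left.
  have [bx|bx] := leP 1 (2^-1 + mdist x (c b)); first by right.
  lra.
by move=> [] ->; rewrite (min_l u1) ?(min_l (capped_dist_le1 _ _))
  ?(min_r (capped_dist_le1 _ _)) // addrC.
Qed.

Variable D : nat -> X.
Hypothesis hD : dense (range D).

(* The convex combination of y and z is 1/2 on an equilateral triangle, whose sides
   have length 1: this forces y and z to be 1/2 there as well. The Lipschitz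
   condition then bounds y from above by the largest extension. *)
Lemma Sprime_le_capped_dist S (y z : RN R) (t : R) :
  (diameter X <= 1)%E -> (2 < #|S|)%N -> Sprime D y -> Sprime D z ->
  0 < t < 1 ->
  (fun m => capped_dist S (D m)) = t *: y + (1 - t) *: z ->
  forall m, y m <= capped_dist S (D m).
Proof.
move=> dX S3 Sy Sz /andP[t0 t1] E m.
apply: le_bigmin => [|i iS].
  by have /andP[] := Sprime_cube dX Sy m.
(* Two further indices complete [i] to a triangle. *)
have /card_gt1P[k [l [kS lS kl]]] : (1 < #|S :\ i|)%N.
  by move: S3; rewrite (cardsD1 i) iS.
move: kS lS; rewrite !in_setD1 => /andP[ki kS] /andP[li lS].
apply/ler_addgt0Pl => e e0.
(* The final error is at most 4d/t + 2d, which is below e as t < 1. *)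
pose d := e * t / 10; have d0 : 0 < d by rewrite divr_gt0// mulr_gt0.
have [mi ei] := dense_near (c i) hD d0.
have [mk ek] := dense_near (c k) hD d0.
have [ml el] := dense_near (c l) hD d0.
have fE q : capped_dist S (D q) = t * y q + (1 - t) * z q.
  by have := congr1 (@^~ q) E.
(* On a side, the combination sums to at most 1 + 2d, while [y] and [z] each sum to at least 1 -
   2d. *)
have sum_le q q' a b : a \in S -> b \in S -> a != b ->
    mdist (c a) (D q) < d -> mdist (c b) (D q') < d ->
    t * (y q + y q') <= t + 4 * d /\ 1 - 2 * d <= y q + y q'.
  move=> aS bS ab aq bq.
  have := capped_dist_le (D q) aS; have := capped_dist_le (D q') bS.
  rewrite !fE (metric_sym (D q)) (metric_sym (D q')).
  have ab1 : 1 - 2 * d <= mdist (D q) (D q').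
    have := metric_triangle (c a) (D q) (c b).
    have := metric_triangle (D q) (D q') (c b).
    by rewrite c1// (metric_sym (D q') (c b)); lra.
  have := Sprime_sum q q' Sy; have := Sprime_sum q q' Sz.
  move=> zz yy; split; nra.
(* The value of [y] near [c i] is half of the two sums over the sides at [i] minus the sum over the
   opposite side. *)
have [] := sum_le _ _ _ _ iS kS _ ei ek; first by rewrite eq_sym.
have [] := sum_le _ _ _ _ iS lS _ ei el; first by rewrite eq_sym.
have [] := sum_le _ _ _ _ kS lS kl ek el.
have := Sprime_lipschitz m mi Sy.
have := metric_triangle (D m) (c i) (D mi).
have : d * 10 = e * t by rewrite /d divfK.
nra.
Qed.

(** Both [y] and [z] lie below f_S, and a combination with positive weights reaches it only if both
    equal it. *)
Lemma capped_dist_extreme S : (diameter X <= 1)%E -> (2 < #|S|)%N ->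
  Sprime D (fun m => capped_dist S (D m)) ->
  extreme_points (Sprime D) (fun m => capped_dist S (D m)).
Proof.
move=> dX S3 Sf; split=> // y z t Sy Sz t01 E.
have yf := Sprime_le_capped_dist dX S3 Sy Sz t01 E.
have t01' : 0 < 1 - t < 1 by lra.
have zf : forall m, z m <= capped_dist S (D m).
  apply: (Sprime_le_capped_dist dX S3 Sz Sy t01').
  by rewrite E addrC; congr (_ + _ *: _); ring.
have fE q : capped_dist S (D q) = t * y q + (1 - t) * z q.
  by have := congr1 (@^~ q) E.
by split; apply/funext => m; have := yf m; have := zf m; have := fE m; nra.
Qed.

(** Near [c a] the first function is close to 1/2, the second close to 1. *)
Lemma capped_dist_neq S T a : a \in S -> a \notin T ->
  (fun m => capped_dist S (D m)) <> (fun m => capped_dist T (D m)).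
Proof.
move=> aS aT E.
have e0 : 0 < 8^-1 :> R by [].
have [m am] := dense_near (c a) hD e0.
have Sm := capped_dist_le (D m) aS.
have Ta : capped_dist T (c a) = 1.
  apply: bigmin_eq_id => i iT; rewrite c1; first by lra.
  by apply: contraNneq aT => ->.
have := capped_dist_lipschitz T (c a) (D m).
have : capped_dist S (D m) = capped_dist T (D m).
  by have := congr1 (@^~ m) E.
move: Sm; rewrite (metric_sym (D m)); lra.
Qed.

End equilateral.

(** * Two midpoint representations in S'(U_1) *)

Lemma capped_dist_Sprime (X Q : metricType R) (j : Q -> X) (D : nat -> X)
    (n : nat) (c : 'I_n -> Q) (S : {set 'I_n}) :
  rational_urysohn_sphere Q -> (forall x y, mdist (j x) (j y) = mdist x y) ->
  dense (range j) -> (diameter X <= 1)%E ->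
  Sprime D (fun m => capped_dist (j \o c) S (D m)).
Proof.
move=> QU jd jD dX; apply: (katetov_Sprime QU jd jD).
- move=> x; rewrite capped_dist_le1 andbT.
  by apply: le_trans (capped_dist_ge _ _ _); rewrite invr_ge0.
- move=> x y.
  have d1 : mdist x y <= 1.
    rewrite -lee_fin; apply: le_trans dX.
    by apply: ereal_sup_ubound; exists (x, y).
  have := capped_dist_lipschitz (j \o c) S x y.
  have := capped_dist_lipschitz (j \o c) S y x.
  have := capped_dist_ge (j \o c) S x; have := capped_dist_ge (j \o c) S y.
  by rewrite (metric_sym y) ler_norml => *; apply/andP; split; lra.
(* Rationality on [Q] holds because the centers [c i] lie in [Q]. *)
- move=> q; apply: (big_ind (fun x => exists r : rat, x = ratr r))
    => [|x y [r ->] [s ->]|i _].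
  + by exists 1%Q; rewrite rmorph1.
  + by rewrite minEle; case: ifP => _; eexists.
  + have [_ /(_ q (c i))[r qr] _ _] := QU.
    by exists (2^-1 + r); rewrite /= jd qr rmorphD/= fmorphV/= rmorph_nat.
Qed.

Lemma Sprime_two_midpoints (X : metricType R) (D : nat -> X) :
  urysohn_sphere X -> dense (range D) ->
  exists p q r s : RN R,
  [/\ [/\ extreme_points (Sprime D) p, extreme_points (Sprime D) q,
          extreme_points (Sprime D) r & extreme_points (Sprime D) s],
      2^-1 *: p + 2^-1 *: q = 2^-1 *: r + 2^-1 *: s, p <> r & p <> s].
Proof.
move=> XU hD; have dX := urysohn_sphere_diameter XU.
have [_ [Q [j [QU jd jD]]]] := XU.
have [c cE] := rational_urysohn_equilateral 5 QU.
have c1 i k : i != k -> mdist ((j \o c) i) ((j \o c) k) = 1.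
  by move=> ik; rewrite /= jd cE.
pose f S : RN R := fun m => capped_dist (j \o c) S (D m).
pose a : 'I_5 := inord 3; pose b : 'I_5 := inord 4.
have ab : a != b by rewrite -val_eqE /= !inordK.
pose S := ~: [set a; b].
have S3 : #|S| = 3%N.
  by have := cardsC [set a; b]; rewrite cards2 ab card_ord => -[].
have ext (T : {set 'I_5}) : S \subset T -> extreme_points (Sprime D) (f T).
  move=> ST; apply: capped_dist_extreme => //.
    by apply: leq_trans (subset_leq_card ST); rewrite S3.
  exact: capped_dist_Sprime.
exists (f (S :|: [set a])), (f (S :|: [set b])), (f S),
  (f (S :|: ([set a] :|: [set b]))); split.
- by split; apply: ext; rewrite ?finset.subsetUl ?subxx.
- have E m : 2^-1 * f (S :|: [set a]) m + 2^-1 * f (S :|: [set b]) m =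
      2^-1 * f S m + 2^-1 * f (S :|: ([set a] :|: [set b])) m.
    by rewrite -!mulrDr /f (capped_dist_modular c1).
  exact: (funext E).
(* The index [a] separates [p] from [r]; below, [b] separates [s] from [p]. *)
- by apply: (capped_dist_neq c1 hD (a := a)); rewrite !inE eqxx ?orbT.
- apply/nesym; apply: (capped_dist_neq c1 hD (a := b)).
    by rewrite !inE eqxx !orbT.
  by rewrite !inE eqxx orbT/= eq_sym.
Qed.

End urysohn.

(** * Transfer along affine bijections and conclusion *)

Lemma affine_bij_extreme_points (R : realType) (E F : lmodType R) (K : set E)
    (L : set F) (f : E -> F) (x : E) :
  set_bij K L f ->
  (forall (y z : E) (t : R), K y -> K z -> 0 <= t <= 1 ->
    K (t *: y + (1 - t) *: z)) ->
  (forall (y z : E) (t : R), K y -> K z -> 0 <= t <= 1 ->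
    f (t *: y + (1 - t) *: z) = t *: f y + (1 - t) *: f z) ->
  extreme_points K x -> extreme_points L (f x).
Proof.
move=> [fK fI fS] cK fA [Kx xE]; split; first exact: fK.
move=> _ _ t /fS[y Ky <-] /fS[z Kz <-] t01.
have t01' : 0 <= t <= 1 by lra.
rewrite -fA// => /fI; rewrite !in_setE => /(_ Kx (cK _ _ _ Ky Kz t01')).
by move=> /(xE _ _ _ Ky Kz t01)[-> ->].
Qed.

Theorem theorem8p1 (R : realType) (X : metricType R) (D : nat -> X)
    (hX : urysohn_sphere X) (hD : dense (range D)) :
  ~ choquet_simplex (Sprime D) /\
  (forall (E : tvsType R) (K : set E), hausdorff_space E ->
     poulsen_simplex K -> ~ affinely_homeomorphic (Sprime D) K).
Proof.
have [p [q [r [s [[ep eq er es] pqrs pr ps]]]]] := Sprime_two_midpoints hX hD.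
have convD (y z : RN R) (t : R) : Sprime D y -> Sprime D z -> 0 <= t <= 1 ->
    Sprime D (t *: y + (1 - t) *: z).
  move=> Sy Sz t01; pose t' := Itv01 (andP t01).1 (andP t01).2.
  by apply/set_mem; apply: (@Sprime_convex _ _ D y z t'); exact/mem_set.
have half : 0 <= (2^-1 : R) <= 1 by lra.
have halfE : 1 - 2^-1 = 2^-1 :> R by lra.
have Spq : Sprime D (2^-1 *: p + 2^-1 *: q).
  by have := convD _ _ _ ep.1 eq.1 half; rewrite halfE.
split.
  exact: (not_choquet_simplex (@RN_hausdorff R) Spq ep eq er es pqrs pr ps).
(* A Poulsen simplex is a Choquet simplex, so carrying the four extreme points to [K] by [f] gives
   the contradiction. *)
move=> E K hE [Ksimplex _ _] [f [_ [fK _ _ _ fA]]].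
have ext x := affine_bij_extreme_points (x := x) fK convD fA.
have fhalf y z : Sprime D y -> Sprime D z ->
    f (2^-1 *: y + 2^-1 *: z) = 2^-1 *: f y + 2^-1 *: f z.
  by move=> Sy Sz; have := fA y z _ Sy Sz half; rewrite halfE.
have [fS fI _] := fK.
have finj x : extreme_points (Sprime D) x -> p <> x -> f p <> f x.
  by move=> ex px /fI; rewrite !in_setE => /(_ ep.1 ex.1).
apply: (not_choquet_simplex hE _ (ext _ ep) (ext _ eq) (ext _ er) (ext _ es)
  _ (finj _ er pr) (finj _ es ps) Ksimplex).
  by rewrite -fhalf; [exact: fS|exact: ep.1|exact: eq.1].
by rewrite -!fhalf ?pqrs//; [exact: er.1|exact: es.1|exact: ep.1|exact: eq.1].
Qed.
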